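(* Let $K$ be a field, $S=K[x_1,\ldots,x_n]$, and let $I\subset S$ be an unmixed monomial ideal of codimension $2$ which is generically a complete intersection. Then the following conditions are equivalent: (a) $I^k=I^{(k)}$ for all $k$. (b) $I^2=I^{(2)}$. (c) $I$ is a trivial modification of a vertex cover ideal of a bipartite graph.
   Context: Symbolic powers: a monomial ideal $I\subset S$ has a unique irredundant presentation $I=\bigcap_{j} C_j$ as an intersection of irreducible monomial ideals (ideals of the form $(x_{i_1}^{a_1},\ldots,x_{i_k}^{a_k})$). For each prime $P$ occurring as a radical $\sqrt{C_j}$, intersect all the $C_j$ with radical $P$; this gives a canonical primary decomposition $I=\bigcap_{i=1}^r Q_i$ with $Q_i$ being $P_i$-primary and the $P_i$ pairwise distinct. The $k$th symbolic power of $I$ is $I^{(k)}=\bigcap_{i=1}^r Q_i^k$. A monomial ideal $I$ of codimension (height) $2$ is unmixed if all its associated primes have height $2$, and generically a complete intersection if its localization at each minimal prime is a complete intersection. A monomial ideal of codimension 2 has both properties if and only if it can be written as $I=\bigcap_{1\le i<j\le n}(x_i^{a_{ij}},x_j^{a_{ji}})$ with non-negative integers $a_{ij}$. Pairs with $a_{ij}=0$ or $a_{ji}=0$ contribute the unit ideal $S$ and may be omitted, so that $I=\bigcap_{\{i,j\}\in E(G)}(x_i^{a_{ij}},x_j^{a_{ji}})$ for a simple graph $G$ on $\{1,\ldots,n\}$, with $a_{ij},a_{ji}>0$ for every edge $\{i,j\}$ of $G$. The vertex cover ideal of a simple graph $G$ on $\{1,\ldots,n\}$ is $I_G=\bigcap_{\{i,j\}\in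 E(G)}(x_i,x_j)$. Trivial modification: $J=\bigcap_{1\le i<j\le n}(x_i^{b_{ij}},x_j^{b_{ji}})$ is a trivial modification of $I=\bigcap_{1\le i<j\le n}(x_i^{a_{ij}},x_j^{a_{ji}})$ if there exist integers $c_i>0$ with $b_{ij}=c_ia_{ij}$ for all $i$ and $j$ (equivalently, $J$ arises from $I$ by the substitution $x_i\mapsto x_i^{c_i}$, $i=1,\ldots,n$). In particular, $\bigcap_{\{i,j\}\in E(G)}(x_i^{a_{ij}},x_j^{a_{ji}})$ is a trivial modification of $I_G$ if there are integers $c_i>0$ with $a_{ij}=c_i$ and $a_{ji}=c_j$ for every edge $\{i,j\}$ of $G$. *)

(* Defs.v *)
From mathcomp Require Import all_boot all_order all_algebra.
From mathcomp Require Import boolp classical_sets cardinality.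
From mathcomp Require Import fraction mpoly.

Set Implicit Arguments.
Unset Strict Implicit.
Unset Printing Implicit Defensive.

Import GRing.Theory.

Local Open Scope classical_set_scope.
Local Open Scope ring_scope.

Section Ideals.
Variable R : comNzRingType.
Implicit Types (A X J : set R) (s : seq R).

(* The [A]-submodule of [R] generated by [X]; for a subring [A] of [R] and
   [X `<=` A] this is the ideal of the ring [A] generated by [X]. *)
Definition span_over A X : set R :=
  [set y | exists s : seq (R * R),
     (forall p, p \in s -> A p.1 /\ X p.2) /\ y = \sum_(p <- s) p.1 * p.2].

Definition ideal_gen X : set R := span_over setT X.

Definition ideal_mul I J : set R := ideal_gen [set f * g | f in I & g in J].

Definition ideal_pow I (k : nat) : set R := iter k (ideal_mul I) setT.

Definition radical I : set R := [set f | exists m : nat, I (f ^+ m)].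

(* [idealr_closed] includes properness. *)
Definition prime_ideal (P : set R) : Prop :=
  idealr_closed (mem P) /\ prime_idealr_closed (mem P).

Definition minimal_prime I (P : set R) : Prop :=
  [/\ prime_ideal P, I `<=` P &
      forall Q, prime_ideal Q -> I `<=` Q -> Q `<=` P -> Q = P].

(* Associated primes of the module [R / I]. *)
Definition associated_prime I (P : set R) : Prop :=
  prime_ideal P /\ exists f : R, P = [set g | I (g * f)].

Definition prime_chain (P : set R) (h : nat) : Prop :=
  exists Q : nat -> set R,
    [/\ forall i, (i <= h)%N -> prime_ideal (Q i),
        forall i, (i < h)%N -> Q i `<` Q i.+1 & Q h = P].

(* A chain ending at [P] can be truncated at its lower end, so the lengths of
   the chains ending at [P] form an initial segment of [nat]. *)
Definition prime_has_height (P : set R) (h : nat) : Prop :=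
  prime_chain P h /\ ~ prime_chain P h.+1.

(* The infimum of the heights of the primes containing [I] is [h]. *)
Definition has_height I (h : nat) : Prop :=
  (forall P, prime_ideal P -> I `<=` P -> prime_chain P h) /\
  (exists P, [/\ prime_ideal P, I `<=` P & prime_has_height P h]).

Definition unmixed I (h : nat) : Prop :=
  forall P, associated_prime I P -> prime_has_height P h.

(* [s] is a regular sequence in the subring [A]. *)
Definition regular_sequence A s : Prop :=
  (forall t, (t < size s)%N ->
     A s`_t /\
     forall u, A u -> span_over A [set` take t s] (s`_t * u) ->
               span_over A [set` take t s] u) /\
  ~ span_over A [set` s] 1.

Definition complete_intersection A J : Prop :=
  exists s, regular_sequence A s /\ J = span_over A [set` s].

End Ideals.

Section Localization.
Variable R : idomainType.
Implicit Types I P : set R.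

(* The extension of [I] to the localization [R_P], which is realised inside
   the fraction field of [R]; [localize P setT] is the ring [R_P] itself. *)
Definition localize P I : set {fraction R} :=
  [set tofrac f / tofrac g | f in I & g in ~` P].

Definition generically_complete_intersection I : Prop :=
  forall P, minimal_prime I P ->
    complete_intersection (localize P setT) (localize P I).

End Localization.

Section MonomialIdeals.
Variables (K : fieldType) (n : nat).
Local Notation S := {mpoly K[n]}.
Implicit Types (I J C P : set S) (D : set (set S)) (G : rel 'I_n).

Definition monomial_ideal I : Prop :=
  exists M : set 'X_{1..n}, I = ideal_gen [set 'X_[m] | m in M].

(* A zero entry of [a] means that no power of that variable is a generator. *)
Definition irreducible_monomial_ideal C : Prop :=
  exists a : 'I_n -> nat, C = ideal_gen [set 'X_i ^+ a i | i in [set i | (0 < a i)%N]].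

Definition irredundant_presentation I D : Prop :=
  [/\ finite_set D,
      forall C, D C -> irreducible_monomial_ideal C,
      I = \bigcap_(C in D) C &
      forall C, D C -> I <> \bigcap_(C' in D `\ C) C'].

(* The irredundant presentation of a monomial ideal exists and is unique, so
   the choice made by [xget] is immaterial. *)
Definition irreducible_components I : set (set S) :=
  xget set0 [set D | irredundant_presentation I D].

Definition primary_component I P : set S :=
  \bigcap_(C in [set C | irreducible_components I C /\ radical C = P]) C.

Definition symbolic_power I (k : nat) : set S :=
  \bigcap_(P in [set radical C | C in irreducible_components I])
    ideal_pow (primary_component I P) k.

Definition power_ideal2 (i j : 'I_n) (a b : nat) : set S :=
  ideal_gen [set 'X_i ^+ a; 'X_j ^+ b].

Definition ideal_of_exponents (a : 'I_n -> 'I_n -> nat) : set S :=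
  \bigcap_(e in [set e : 'I_n * 'I_n | (e.1 < e.2)%N])
    power_ideal2 e.1 e.2 (a e.1 e.2) (a e.2 e.1).

Definition trivial_modification J I : Prop :=
  exists (a b : 'I_n -> 'I_n -> nat) (c : 'I_n -> nat),
    [/\ I = ideal_of_exponents a, J = ideal_of_exponents b,
        forall i, (0 < c i)%N &
        forall i j, b i j = (c i * a i j)%N].

Definition simple_graph G : Prop := ssrbool.symmetric G /\ irreflexive G.

Definition bipartite G : Prop :=
  exists V : {set 'I_n}, forall i j, G i j -> (i \in V) != (j \in V).

Definition vertex_cover_ideal G : set S :=
  \bigcap_(e in [set e : 'I_n * 'I_n | G e.1 e.2]) ideal_gen [set 'X_(e.1); 'X_(e.2)].

End MonomialIdeals.

(* Main.v *)
Require Import Defs.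
From mathcomp Require Import all_boot all_order all_algebra.
From mathcomp Require Import boolp classical_sets cardinality.
From mathcomp Require Import fraction mpoly.
From mathcomp Require Import zify.

(* Write [m] for exponent vectors. A monomial ideal with the required properties
   is the intersection of its localizations at the primes [(x_i, x_j)], because
   every monomial outside [I] is kept out of [I] by the localization at some
   monomial associated prime, and these have height 2. Such a localization is
   [(x_i^a_ij, x_j^a_ji)]: relations on a regular sequence have coefficients in
   the ideal it generates, which rules out a third minimal monomial generator.
   Hence [x^m] lies in [I] when [a_ij <= m_i] or [a_ji <= m_j] for all [i, j], and
   in [I^(k)] when [k <= m_i %/ a_ij + m_j %/ a_ji] for all edges.

   If [I^2 = I^(2)], testing monomials with large exponents outside three
   vertices excludes triangles and shows that [a_ij = c_i] does not depend on
   [j]; splitting the monomial with exponents [c_i] gives a bipartition.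
   Conversely, on a bipartite graph a cover can be split off every
   [(k+1)]-cover, leaving a [k]-cover. *)

Set Implicit Arguments.
Unset Strict Implicit.
Unset Printing Implicit Defensive.

Import GRing.Theory.

Local Open Scope classical_set_scope.
Local Open Scope ring_scope.

(** * Spans over a subring, and monomial ideals as sets of exponent vectors *)

Section SpanOver.
Variable R : comNzRingType.
Implicit Types (A X : set R).

Lemma span_over0 A X : span_over A X 0.
Proof. by exists [::]; rewrite big_nil. Qed.

Lemma span_overD A X f g :
  span_over A X f -> span_over A X g -> span_over A X (f + g).
Proof.
move=> [s [hs ->]] [t [ht ->]]; exists (s ++ t); rewrite big_cat; split=> // p.
by rewrite mem_cat => /orP[/hs|/ht].
Qed.

Lemma span_over_sum A X (J : eqType) (r : seq J) (F : J -> R) :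
  (forall j, j \in r -> span_over A X (F j)) ->
  span_over A X (\sum_(j <- r) F j).
Proof.
elim: r => [|j r IH] hF; first by rewrite big_nil; apply: span_over0.
rewrite big_cons; apply: span_overD; first by apply: hF; rewrite mem_head.
by apply: IH => k kr; apply: hF; rewrite in_cons kr orbT.
Qed.

Lemma span_overM A X a x : A a -> X x -> span_over A X (a * x).
Proof.
move=> Aa Xx; exists [:: (a, x)]; rewrite big_seq1; split=> // p.
by rewrite mem_seq1 => /eqP->.
Qed.

Lemma span_overMl A X a f :
    (forall x y, A x -> A y -> A (x * y)) ->
  A a -> span_over A X f -> span_over A X (a * f).
Proof.
move=> AM Aa [s [hs ->]]; rewrite mulr_sumr; apply: span_over_sum => p /hs[A1 X2].
by rewrite mulrA; apply: span_overM => //; apply: AM.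
Qed.

Lemma span_over_sub A X Y : X `<=` Y -> span_over A X `<=` span_over A Y.
Proof. by move=> XY f [s [hs ->]]; exists s; split=> // p /hs[? /XY]. Qed.

End SpanOver.

(* A monomial ideal is handled through its set of exponent vectors. *)
Section MonomialSpan.
Variables (K : fieldType) (n : nat).
Local Notation S := {mpoly K[n]}.
Implicit Types (T U : set 'X_{1..n}) (m : 'X_{1..n}) (f g : S).

Definition upclosed T := forall m m', (m <= m')%MM -> T m -> T m'.

Definition mon_ideal T : set S := [set f | forall m, m \in msupp f -> T m].

Definition mon_add T U : set 'X_{1..n} := [set (p + q)%MM | p in T & q in U].

Lemma mon_ideal0 T : mon_ideal T 0.
Proof. by move=> m; rewrite msupp0. Qed.

Lemma mon_idealD T f g : mon_ideal T f -> mon_ideal T g -> mon_ideal T (f + g).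
Proof. by move=> hf hg m /msuppD_le; rewrite mem_cat => /orP[/hf|/hg]. Qed.

Lemma mon_idealM T U f g :
  mon_ideal T f -> mon_ideal U g -> mon_ideal (mon_add T U) (f * g).
Proof.
move=> hf hg m /msuppM_le/allpairsP[[p q] /= [/hf Tp /hg Uq ->]].
by exists p => //; exists q.
Qed.

Lemma mon_ideal_le T U : T `<=` U -> mon_ideal T `<=` mon_ideal U.
Proof. by move=> TU f hf m /hf/TU. Qed.

Lemma mon_idealMl T f g : upclosed T -> mon_ideal T g -> mon_ideal T (f * g).
Proof.
move=> Tup hg m /msuppM_le/allpairsP[[p q] /= [_ /hg Tq ->]].
exact: Tup (lem_addl _ _) Tq.
Qed.

Lemma mon_idealX T m : mon_ideal T 'X_[m] <-> T m.
Proof.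
split=> [/(_ m)|Tm m']; first by rewrite msuppX mem_seq1 eqxx; apply.
by rewrite msuppX mem_seq1 => /eqP->.
Qed.

Lemma mon_ideal_inj T U : mon_ideal T = mon_ideal U -> T = U.
Proof.
move=> e; apply/seteqP; split=> m; first by move/mon_idealX; rewrite e => /mon_idealX.
by move/mon_idealX; rewrite -e => /mon_idealX.
Qed.

Lemma mon_ideal_setT : mon_ideal setT = setT.
Proof. by apply/seteqP; split. Qed.

Lemma mon_ideal_bigcap (J : Type) (D : set J) (T : J -> set 'X_{1..n}) :
  \bigcap_(j in D) mon_ideal (T j) = mon_ideal (\bigcap_(j in D) T j).
Proof.
apply/seteqP; split=> f hf; first by move=> m fm j Dj; apply: hf Dj _ fm.
by move=> j Dj m fm; apply: hf fm _ Dj.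
Qed.

Lemma ideal_gen_mon (X : set S) T : upclosed T -> X `<=` mon_ideal T ->
  (forall m, T m -> ideal_gen X 'X_[m]) -> ideal_gen X = mon_ideal T.
Proof.
move=> Tup XT TX; apply/seteqP; split=> f.
  case=> s [hs ->]; rewrite big_seq.
  apply: (big_ind (mon_ideal T)); [exact: mon_ideal0| |].
    by move=> x y; apply: mon_idealD.
  by move=> p /hs[_ /XT]; apply: mon_idealMl.
move=> hf; rewrite [f]mpolyE; apply: span_over_sum => m /hf/TX.
by rewrite -mul_mpolyC; apply: span_overMl.
Qed.

Lemma upclosed_add T U : upclosed T -> upclosed (mon_add T U).
Proof.
move=> Tup _ m' /[swap] -[p Tp [q Uq <-]] le; exists (p + (m' - (p + q)))%MM.
  exact: Tup (lem_addr _ _) Tp.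
exists q => //; apply/mnmP=> i; move/mnm_lepP/(_ i): le; rewrite !mnmE; lia.
Qed.

Lemma ideal_mul_mon T U : upclosed T ->
  ideal_mul (mon_ideal T) (mon_ideal U) = mon_ideal (mon_add T U).
Proof.
move=> Tup; apply: ideal_gen_mon; first exact: upclosed_add.
  by move=> _ [f hf [g hg <-]]; apply: mon_idealM.
move=> _ [p Tp [q Uq <-]]; rewrite -['X_[_]]mul1r; apply: span_overM => //.
by exists 'X_[p]; [exact/mon_idealX|exists 'X_[q]; [exact/mon_idealX|rewrite mpolyXD]].
Qed.

Definition mon_pow T k : set 'X_{1..n} := iter k (mon_add T) setT.

Lemma ideal_pow_mon T k : upclosed T ->
  ideal_pow (mon_ideal T) k = mon_ideal (mon_pow T k).
Proof.
move=> Tup; elim: k => [|k IH]; first by rewrite /= mon_ideal_setT.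
by rewrite /ideal_pow iterS -/(ideal_pow _ k) IH ideal_mul_mon.
Qed.

(** The iteration in [mon_pow] starts from all exponent vectors; the arbitrary remainder [r] turns
    equalities into inequalities. *)
Lemma mon_pow2 T m : upclosed T -> mon_pow T 2 m ->
  exists p q, [/\ T p, T q & forall i, (p i + q i <= m i)%N].
Proof.
move=> Tup [p Tp [_ [q Tq [r _ <-]] <-]]; exists p, q; split=> // i.
by rewrite !mnmE; lia.
Qed.

Lemma monomial_idealP I : monomial_ideal I ->
  exists2 T, upclosed T & I = mon_ideal T.
Proof.
case=> M ->; exists [set m | exists2 m', M m' & (m' <= m)%MM].
  by move=> m m' le [p Mp pm]; exists p => //; apply: lepm_trans le.
apply: ideal_gen_mon.
- by move=> m m' le [p Mp pm]; exists p => //; apply: lepm_trans le.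
- move=> _ [m Mm <-]; apply/mon_idealX; exists m => //; exact: lepm_refl.
- move=> m [p Mp /submK <-]; rewrite mpolyXD; apply: span_overM => //.
  by exists p.
Qed.

End MonomialSpan.

(** * Chains of primes and primes generated by variables *)

Section Heights.
Variable R : comNzRingType.

Lemma prime_chain0 (P : set R) : prime_ideal P -> prime_chain P 0.
Proof. by move=> Pp; exists (fun=> P); split=> // i; rewrite leqn0 => /eqP->. Qed.

Lemma prime_chain_extend (P Q : set R) h :
  prime_chain Q h -> prime_ideal P -> Q `<` P -> prime_chain P h.+1.
Proof.
case=> C [Cp Clt CQ] Pp QP; exists (fun i => if (i <= h)%N then C i else P).
split; last by rewrite ltnn.
  by move=> i _; case: ifP => // /Cp.
move=> i; rewrite ltnS => ih; rewrite ih; case: ltnP => hi; first exact: Clt.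
by rewrite (_ : i = h) ?CQ //; apply/eqP; rewrite eqn_leq ih.
Qed.

End Heights.

Section VariablePrimes.
Variables (K : fieldType) (n : nat).
Local Notation S := {mpoly K[n]}.
Implicit Types (F : {set 'I_n}) (T : set 'X_{1..n}) (m w : 'X_{1..n}).

Definition meets F : set 'X_{1..n} := [set m | exists2 i, i \in F & m i != 0%N].

Definition var_ideal F : set S := mon_ideal (meets F).

Lemma upclosed_meets F : upclosed (meets F).
Proof.
move=> m m' /mnm_lepP le [i iF mi]; exists i => //.
by move: (le i); rewrite -!lt0n in mi *; apply: leq_trans.
Qed.

Lemma meetsPn F m : ~ meets F m <-> forall i, i \in F -> m i = 0%N.
Proof.
split=> [h i iF|h [i /h ->]] //.
by apply/eqP/negPn/negP => mi; apply: h; exists i.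
Qed.

(** Setting the variables of [F] to zero is an endomorphism of the domain [S]; primality is read off
    from this kernel. *)
Lemma var_ideal_ker F :
  exists phi : {rmorphism S -> S}, var_ideal F = [set f | phi f = 0].
Proof.
pose lq := [tuple (if i \in F then 0 else 'X_i : S) | i < n].
have eX m : meets F m -> 'X_[m] \mPo lq = 0.
  case=> i iF mi; rewrite comp_mpolyX (bigD1 i) //= tnth_mktuple iF.
  by rewrite expr0n (negbTE mi) mul0r.
have eXn m : ~ meets F m -> 'X_[m] \mPo lq = 'X_[m].
  move/meetsPn => h; rewrite comp_mpolyX [RHS]mpolyXE_id; apply: eq_bigr => i _.
  by rewrite tnth_mktuple; case: ifP => // /h ->; rewrite !expr0.
exists (comp_mpoly lq); apply/seteqP; split=> f /=.
  move=> hf; rewrite comp_mpolyEX big_seq big1 // => m /hf /eX ->.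
  by rewrite scaler0.
move=> e m fm; apply: contrapT => nm; move: fm; rewrite mcoeff_msupp => /negP; apply.
have := congr1 (mcoeff m) e; rewrite comp_mpolyEX mcoeff0 raddf_sum /= => <-.
rewrite {1}[f]mpolyE raddf_sum /=; apply/eqP; apply: eq_bigr => p _.
rewrite !mcoeffZ; congr (_ * _); case: (pselect (meets F p)) => hp; last by rewrite eXn.
rewrite eX // mcoeff0 mcoeffX; case: eqP => // pm; by rewrite pm in hp.
Qed.

Lemma var_ideal_prime F : prime_ideal (var_ideal F).
Proof.
have [phi ->] := var_ideal_ker F; split; first split.
- by rewrite inE /= rmorph0.
- by apply/negP; rewrite inE /= rmorph1; apply/eqP; rewrite oner_eq0.
- by move=> a u v; rewrite !inE /= rmorphD rmorphM => -> ->; rewrite mulr0 addr0.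
move=> u v; rewrite inE /= rmorphM => /eqP; rewrite mulf_eq0.
by case/orP=> /eqP h; apply/orP; [left|right]; rewrite inE.
Qed.

Lemma var_ideal_sub F F' : F \subset F' -> var_ideal F `<=` var_ideal F'.
Proof. by move/fintype.subsetP=> s f hf m /hf [i /s]; exists i. Qed.

Lemma var_idealX F i : var_ideal F 'X_i <-> i \in F.
Proof.
split=> [/mon_idealX[j jF]|iF]; first by rewrite mnm1E eqb0 negbK => /eqP->.
by apply/mon_idealX; exists i => //; rewrite mnm1E eqxx.
Qed.

Lemma var_ideal_proper F F' i :
  F \subset F' -> i \in F' -> i \notin F -> var_ideal F `<` var_ideal F'.
Proof.
move=> s iF' iF; split; first exact: var_ideal_sub.
by move=> /(_ 'X_i) h; case/negP: iF; apply/var_idealX/h/var_idealX.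
Qed.

(** Three variables of [F] give the chain [0 < (x_i) < (x_i, x_j) < var_ideal F]. *)
Lemma var_ideal_chain3 F : (2 < #|F|)%N -> prime_chain (var_ideal F) 3.
Proof.
case/card_gt2P=> i [j [k [[iF jF kF] [ij jk ki]]]].
have p0 : prime_chain (var_ideal finset.set0) 0 by apply/prime_chain0/var_ideal_prime.
have p1 : prime_chain (var_ideal [set i]%SET) 1.
  apply: (prime_chain_extend p0); first exact: var_ideal_prime.
  by apply: (@var_ideal_proper _ _ i); rewrite ?finset.sub0set ?finset.in_set0 ?finset.in_set1.
have p2 : prime_chain (var_ideal [set i; j]%SET) 2.
  apply: (prime_chain_extend p1); first exact: var_ideal_prime.
  apply: (@var_ideal_proper _ _ j);
    rewrite ?finset.in_set2 ?finset.in_set1 ?eqxx ?orbT ?(eq_sym j) //.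
  by apply/fintype.subsetP=> x; rewrite ?finset.in_set2 ?finset.in_set1 => ->.
apply: (prime_chain_extend p2); first exact: var_ideal_prime.
apply: (@var_ideal_proper _ _ k); rewrite ?finset.in_set2 ?negb_or ?ki ?(eq_sym k) ?jk //.
by apply/fintype.subsetP=> x; rewrite ?finset.in_set2 ?finset.in_set1 => /orP[]/eqP->.
Qed.

(* Divide an element of the middle prime by [x_i] as long as possible. *)
Lemma var_ideal1_nochain2 i F : F \subset [set i]%SET -> ~ prime_chain (var_ideal F) 2.
Proof.
move=> Fi [Q [Qp Qlt Q2]].
have [[Q0 _ _] _] := Qp 0%N isT; rewrite inE in Q0.
have [Q01 nQ10] := Qlt 0%N isT; have [] := Qlt 1%N isT; rewrite Q2 => Q12 nQ21.
(* Every monomial of an element of [Q 2] is divisible by [X_i], so [X_i] in [Q 1] would put [Q 2]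
   inside [Q 1]. *)
have Xi : ~ Q 1%N 'X_i.
  have [[_ _ QD] _] := Qp 1%N isT => QX; apply: nQ21 => g hg.
  rewrite [g]mpolyE big_seq; apply: (big_ind (Q 1%N)); first exact: Q01.
    by move=> x y Qx Qy; have := QD 1 x y; rewrite !inE mul1r; apply.
  move=> m /hg [j /(fintype.subsetP Fi)]; rewrite inE => /eqP-> mi.
  have {mi} /submK <- : (U_(i) <= m)%MM by rewrite lep1mP.
  rewrite mpolyXD scalerAl.
  have := QD (g@_(m - U_(i) + U_(i)) *: 'X_[m - U_(i)]) 'X_i 0.
  by rewrite !inE addr0; apply => //; apply: Q01.
have big k : forall f, Q 1%N f -> forall m, m \in msupp f -> (k <= m i)%N.
  elim: k => [|k IH] f Qf m fm //.
  have [g fe] : exists g : S, f = g * 'X_i.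
    exists (\sum_(m <- msupp f) f@_m *: 'X_[m - U_(i)]).
    rewrite {1}[f]mpolyE mulr_suml [LHS]big_seq [RHS]big_seq; apply: eq_bigr => p.
    move=> /(Q12 _ Qf) [j /(fintype.subsetP Fi)]; rewrite inE => /eqP-> pi.
    by rewrite -scalerAl -mpolyXD submK // lep1mP.
  have [_ /(_ g 'X_i)] := Qp 1%N isT.
  rewrite -fe !inE => /(_ Qf) /orP[]; rewrite inE // => Qg.
  move: fm; rewrite fe (perm_mem (msuppMX _ _)) => /mapP[p gp ->].
  by rewrite mnmDE mnm1E eqxx ltnS; apply: IH gp.
apply: nQ10 => f Qf; suff -> : f = 0 by [].
apply: msuppnil0; case e: (msupp f) => [|m s] //.
have /(big (m i).+1 _ Qf) : m \in msupp f by rewrite e mem_head.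
by rewrite ltnn.
Qed.

End VariablePrimes.

(** * Localization at variable primes, on exponent vectors *)

Section ExponentLocalization.
Variables (K : fieldType) (n : nat).
Local Notation S := {mpoly K[n]}.
Implicit Types (F : {set 'I_n}) (T : set 'X_{1..n}) (m w : 'X_{1..n}).

(* The exponents of the contraction of the localization at [var_ideal F]. *)
Definition loc F T : set 'X_{1..n} :=
  [set m | exists2 w, ~ meets F w & T (m + w)%MM].

Lemma upclosed_loc F T : upclosed T -> upclosed (loc F T).
Proof.
move=> Tup m m' /mnm_lepP le [w Fw Tmw]; exists w => //; apply: Tup Tmw.
by apply/mnm_lepP => i; rewrite !mnmDE leq_add2r.
Qed.

Lemma meets0 F : ~ meets F 0%MM.
Proof. by apply/meetsPn => i _; rewrite mnm0E. Qed.

Lemma meets_add F m w : ~ meets F m -> ~ meets F w -> ~ meets F (m + w)%MM.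
Proof.
by move=> /meetsPn hm /meetsPn hw; apply/meetsPn => i iF; rewrite mnmDE hm ?hw.
Qed.

Lemma sub_loc F T : T `<=` loc F T.
Proof. by move=> m Tm; exists 0%MM; [apply: meets0|rewrite addm0]. Qed.

Lemma loc_setT T : loc [set: 'I_n] T = T.
Proof.
apply/seteqP; split; last exact: sub_loc.
move=> m [w /meetsPn w0]; suff -> : w = 0%MM by rewrite addm0.
by apply/mnmP=> i; rewrite w0 ?finset.in_setT ?mnm0E.
Qed.

(** The multiplier [w] can raise the coordinates outside [F] freely, so only those in [F] matter. *)
Lemma loc_eq_on F T m m' :
  upclosed T -> (forall i, i \in F -> m i = m' i) -> loc F T m -> loc F T m'.
Proof.
move=> Tup e [w /meetsPn Fw Tmw].
exists (w + [multinom if i \in F then 0 else m i | i < n])%MM.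
  by apply/meetsPn => i iF; rewrite !mnmE iF Fw.
apply: Tup Tmw; apply/mnm_lepP => i; rewrite !mnmE.
by case: ifP => [/e ->|_]; lia.
Qed.

Lemma sub_meets F T : upclosed T -> ~ loc F T 0%MM -> T `<=` meets F.
Proof.
move=> Tup h m Tm; apply: contrapT => /meetsPn m0; apply: h.
by apply: (@loc_eq_on F T m) => //; [move=> i /m0 ->; rewrite mnm0E|apply: sub_loc].
Qed.

(** Take [F] minimal in [F0] with [m] outside [loc F T]. Above [m], the degree in the variables of
    [F] is bounded outside [loc F T], so some [g] outside enters after multiplication by any
    variable of [F]. A common multiplier [W] avoiding [F] clears denominators, and the colon by the
    monomial [g + W] is [var_ideal F]. *)
Lemma associated_var_ideal F0 T m : upclosed T -> ~ loc F0 T m ->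
  exists F, [/\ F \subset F0, ~ loc F T m &
    associated_prime (mon_ideal T : set S) (var_ideal F)].
Proof.
move=> Tup locm.
have [F /minsetP[/asboolP Fm Fmin] FF0] :=
  @minset_exists _ (fun F => `[< ~ loc F T m >]) _ (asboolT locm).
exists F; split=> //.
(* By minimality [m] enters the localization once [i] is dropped from [F]. Within [F] the multiplier
   is then nonzero at most at [i], and [t i] is its exponent there. *)
have [t ht] : {t : 'I_n -> nat &
    forall i, i \in F -> loc F T (m + U_(i) *+ t i)%MM}.
  apply: (@choice _ _ (fun i u => i \in F -> loc F T (m + U_(i) *+ u)%MM)) => i.
  case: (boolP (i \in F)) => [iF|_]; last by exists 0%N.
  have [w /meetsPn Fw Tw] : loc (F :\ i)%SET T m.
    apply: contrapT => h; have /setP/(_ i) := Fmin _ (asboolT h) (subD1set _ _).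
    by rewrite !finset.inE eqxx iF.
  exists (w i) => _; exists [multinom if j == i then 0 else w j | j < n]%MM.
    apply/meetsPn => j jF; rewrite mnmE; case: eqP => // /eqP ji.
    by apply: Fw; rewrite !finset.inE ji.
  apply: Tup Tw; apply/mnm_lepP => j; rewrite !mnmE mulmnE mnm1E (eq_sym i).
  by case: eqP => [->|_]; lia.
pose deg (g : 'X_{1..n}) := (\sum_(i in F) g i)%N.
pose B := (\sum_(i in F) (m i + t i))%N.
have degB g : (m <= g)%MM -> ~ loc F T g -> (deg g <= B)%N.
  move=> /mnm_lepP mg lg; apply: leq_sum => i iF; rewrite leqNgt; apply/negP => gi.
  apply: lg; apply: upclosed_loc (ht i iF) => //; apply/mnm_lepP => j.
  rewrite mnmDE mulmnE mnm1E; case: eqP => [<-|_]; last by rewrite addn0.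
  by rewrite mul1n ltnW.
(* Otherwise the degree could be raised forever, against [degB]. *)
have [g [lg gmax]] : exists g, ~ loc F T g /\ forall i, i \in F -> loc F T (g + U_(i))%MM.
    apply: contrapT => nog.
    suff unbounded k : exists g, [/\ (m <= g)%MM, ~ loc F T g & (k <= deg g)%N].
      have [g [mg lg]] := unbounded B.+1.
      by rewrite leqNgt ltnS degB.
    elim: k => [|k [g [mg lg kg]]]; first by exists m; split=> //; apply: lepm_refl.
    have /existsNP[i /not_implyP[iF li]] : ~ forall i, i \in F -> loc F T (g + U_(i))%MM.
      by move=> gF; apply: nog; exists g.
    exists (g + U_(i))%MM; split=> //; first exact: lepm_trans mg (lem_addr _ _).
    rewrite /deg (bigD1 i) //= mnmDE mnm1E eqxx addn1 addSn ltnS.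
    apply: leq_trans kg _; rewrite /deg (bigD1 i) //= leq_add2l.
    by apply: leq_sum => j _; rewrite mnmDE leq_addr.
have [w hw] : {w : 'I_n -> 'X_{1..n} &
    forall i, i \in F -> ~ meets F (w i) /\ T (g + U_(i) + w i)%MM}.
  apply: (@choice _ _
    (fun i v => i \in F -> ~ meets F v /\ T (g + U_(i) + v)%MM)) => i.
  case: (boolP (i \in F)) => [iF|_]; last by exists 0%MM.
  by have [v] := gmax i iF; exists v.
pose W := (\sum_(i in F) w i)%MM.
have FW : ~ meets F W.
  apply/meetsPn => j jF; rewrite mnm_sumE big1 // => i iF.
  by have [/meetsPn -> //] := hw i iF.
split; first exact: var_ideal_prime.
exists 'X_[g + W]; apply/seteqP; split=> h.
  move=> hF p; rewrite (perm_mem (msuppMX _ _)) => /mapP[u /hF [i iF ui] ->].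
  have [_] := hw i iF; apply: Tup; apply/mnm_lepP => j; rewrite !mnmE.
  have wW : (w i j <= W j)%N by rewrite mnm_sumE (bigD1 i) //= leq_addr.
  have : ((i == j) <= u j)%N by case: eqP => // <-; rewrite lt0n.
  by move=> iu; rewrite -!addnA leq_add2l addnC; apply: leq_add.
move=> hT u hu; apply: contrapT => uF; apply: lg; exists (W + u)%MM.
  exact: meets_add.
rewrite addmA; apply: hT; rewrite (perm_mem (msuppMX _ _)).
by apply/mapP; exists u.
Qed.

End ExponentLocalization.

(** * Relations on regular sequences *)

Section RegularSequences.
Variables (R : comNzRingType) (A : set R).
Hypotheses (A0 : A 0) (A1 : A 1) (AD : forall x y, A x -> A y -> A (x + y)).
Hypotheses (AN : forall x, A x -> A (- x)) (AM : forall x y, A x -> A y -> A (x * y)).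

Lemma span_over_seq (s : seq R) y : span_over A [set` s] y ->
  exists2 c : nat -> R, forall i, A (c i) & y = \sum_(i < size s) c i * s`_i.
Proof.
case=> r [hr ->] {y}; elim: r hr => [|[a x] r IH] hr.
  by exists (fun=> 0) => //; rewrite big_nil big1 // => i _; rewrite mul0r.
have [|c Ac e] := IH; first by move=> p pr; apply: hr; rewrite in_cons pr orbT.
have [/= Aa xs] := hr (a, x) (mem_head _ _).
(* An entry may be repeated in [s]; its coefficient is credited to the first occurrence. *)
exists (fun i => (if i == index x s then a else 0) + c i).
  by move=> i; apply: AD => //; case: ifP.
rewrite big_cons e /=; under [RHS]eq_bigr do rewrite mulrDl.
rewrite big_split /=; congr (_ + _).
have ix : (index x s < size s)%N by rewrite index_mem.
rewrite (bigD1 (Ordinal ix)) //= eqxx nth_index // big1 ?addr0 // => k.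
by rewrite -val_eqE /= => /negbTE ->; rewrite mul0r.
Qed.

(** Regularity puts the last coefficient [c t] in the span of the first [t] entries. Substituting
    its expansion [d] gives a shorter relation with coefficients [c i + d i * s_t], to which
    induction applies. *)
Lemma regular_sequence_syzygy (s : seq R) : regular_sequence A s ->
  forall t (c : nat -> R), (t <= size s)%N -> (forall i, A (c i)) ->
  \sum_(i < t) c i * s`_i = 0 ->
  forall i, (i < t)%N -> span_over A [set` take t s] (c i).
Proof.
move=> [reg _]; elim=> [//|t IH] c ts Ac; rewrite big_ord_recr /= => e.
have stake u i : (u <= size s)%N -> (i < u)%N -> s`_i \in take u s.
  by move=> us iu; rewrite -(nth_take _ iu) mem_nth // size_takel.
have [Ast regt] := reg t ts.
have ct : span_over A [set` take t s] (c t).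
  apply: regt => //.
  have -> : s`_t * c t = \sum_(i < t) (- c i) * s`_i.
    under eq_bigr do rewrite mulNr.
    by rewrite sumrN; apply/eqP; rewrite -addr_eq0 mulrC addrC e.
  apply: span_over_sum => i _; apply: span_overM; first exact: AN.
  by apply: stake => //; apply: ltnW.
have taket : [set` take t s] `<=` [set` take t.+1 s].
  by move=> x /= xs; rewrite -(take_takel s (leqnSn t)) in xs; apply: mem_take xs.
move=> i; rewrite ltnS leq_eqVlt => /orP[/eqP->|it]; first exact: span_over_sub ct.
have [d Ad ed] := span_over_seq ct.
have sz : size (take t s) = t by rewrite size_takel // ltnW.
rewrite sz in ed.
have := IH (fun i => c i + d i * s`_t) (ltnW ts).
have Ads k : A (c k + d k * s`_t) by apply: AD => //; apply: AM.
move=> /(_ Ads); set z := \sum_(_ < _) _; have -> : z = 0.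
  rewrite -e ed mulr_suml /z -big_split /=; apply: eq_bigr => k _.
  by rewrite nth_take // mulrDl -!mulrA [s`_t * _]mulrC.
move=> /(_ erefl i it) h.
rewrite -(addrK (d i * s`_t) (c i)); apply: span_overD; first exact: span_over_sub h.
by rewrite -mulNr; apply: span_overM; [exact: AN|exact: stake].
Qed.

End RegularSequences.

(** * Localization inside the fraction field *)

Section Localize.
Variables (R : idomainType) (P : set R).
Hypothesis Pprime : prime_ideal P.
Implicit Types (L : set R).

Let P0 : P 0. Proof. by case: Pprime => [[+ _ _] _]; rewrite inE. Qed.

Let frac_neq0 g : ~ P g -> tofrac g != 0.
Proof. by move=> Pg; rewrite tofrac_eq0; apply/eqP => g0; rewrite g0 in Pg. Qed.

Let notinM g h : ~ P g -> ~ P h -> ~ P (g * h).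
Proof.
move=> Pg Ph Pgh; case: Pprime => _ /(_ g h).
by rewrite !inE => /(_ Pgh) /orP[]; rewrite inE.
Qed.

Lemma localize_tofrac L f : L f -> localize P L (tofrac f).
Proof.
move=> Lf; exists f => //; exists 1; last by rewrite tofrac1 divr1.
by case: Pprime => [[_ + _] _]; move=> /negP h P1; apply: h; rewrite inE.
Qed.

(** Three separate sets let this serve for products in [R_P], for multiples of elements of an ideal,
    and for products of ideals. *)
Lemma localizeM L L' N x y : (forall f g, L f -> L' g -> N (f * g)) ->
  localize P L x -> localize P L' y -> localize P N (x * y).
Proof.
move=> LN [f Lf [g Pg <-]] [f' Lf' [g' Pg' <-]].
exists (f * f'); first exact: LN.
exists (g * g'); first exact: notinM.
by rewrite !tofracM mulf_div.
Qed.

Lemma localizeD L x y : (forall f g, L f -> L g -> L (f + g)) ->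
  (forall f g, L g -> L (f * g)) ->
  localize P L x -> localize P L y -> localize P L (x + y).
Proof.
move=> LD LM [f Lf [g Pg <-]] [f' Lf' [g' Pg' <-]].
exists (g' * f + g * f'); first by apply: LD; apply: LM.
exists (g * g'); first exact: notinM.
rewrite !tofracD !tofracM addf_div ?frac_neq0 //.
by rewrite [tofrac g' * _]mulrC [tofrac g * tofrac f']mulrC.
Qed.

Lemma localize_sub L L' : L `<=` L' -> localize P L `<=` localize P L'.
Proof. by move=> LL _ [f /LL Lf [g Pg <-]]; exists f => //; exists g. Qed.

Lemma localizeTN x : localize P setT x -> localize P setT (- x).
Proof.
by move=> [f _ [g Pg <-]]; exists (- f) => //; exists g; rewrite // tofracN mulNr.
Qed.

(* [R_P] is local with maximal ideal [P R_P]. *)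
Lemma localize_unit x : localize P setT x -> ~ localize P P x ->
  x != 0 /\ localize P setT x^-1.
Proof.
move=> [f _ [g Pg <-]] nP.
have Pf : ~ P f by move=> Pf; apply: nP; exists f => //; exists g.
split; first by rewrite mulf_neq0 ?invr_eq0 ?frac_neq0.
by exists g => //; exists f => //; rewrite invf_div.
Qed.

End Localize.

(** * Complete intersections at a prime of two variables *)

Section TwoVariables.
Variables (K : fieldType) (n : nat).
Local Notation S := {mpoly K[n]}.
Implicit Types (F : {set 'I_n}) (T : set 'X_{1..n}) (m : 'X_{1..n}).

(** A denominator outside [var_ideal F] has a monomial [w] avoiding [F], and [m + w] occurs in the
    numerator. *)
Lemma localize_monX F T m :
  localize (var_ideal F) (mon_ideal T : set S) (tofrac 'X_[m]) -> loc F T m.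
Proof.
move=> [f Tf [g Fg /eqP]].
have gn0 : tofrac g != 0.
  by rewrite tofrac_eq0; apply/eqP => g0; apply: Fg; rewrite g0; apply: mon_ideal0.
rewrite eq_sym -(inj_eq (mulIf gn0)) mulfVK // -tofracM tofrac_eq => /eqP e.
have [w gw Fw] : exists2 w, w \in msupp g & ~ meets F w.
  apply: contrapT => h; apply: Fg => w gw; apply: contrapT => Fw.
  by apply: h; exists w.
exists w => //; apply: Tf; rewrite -e mulrC (perm_mem (msuppMX _ _)).
by apply/mapP; exists w.
Qed.

(* If [x^u y^v] lies in the localized ideal with [u < a] and [v < b], the
   relation [y^v * x^a = x^(a-u) * (x^u y^v)] expands along a regular sequence
   generating the ideal [J]. Its coefficients lie in [J], and one of the
   coefficients of [x^a] is a unit since [x^a] is a minimal generator; hence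
   [y^v] lies in [J + (x)], contradicting the minimality of [b]. *)
Lemma complete_intersection_exponents T (i j : 'I_n) a b m :
    upclosed T -> i != j -> let F := [set i; j]%SET in
    complete_intersection (localize (var_ideal F) setT)
      (localize (var_ideal F) (mon_ideal T : set S)) ->
    loc F T (U_(i) *+ a)%MM -> (forall a', loc F T (U_(i) *+ a')%MM -> (a <= a')%N) ->
    (forall b', loc F T (U_(j) *+ b')%MM -> (b <= b')%N) ->
  loc F T m -> (a <= m i)%N \/ (b <= m j)%N.
Proof.
move=> Tup ij F; set P := var_ideal F; set A := localize P setT.
move=> [s [reg eJ]] [w Fw Ta] amin bmin locm.
apply: contrapT => /not_orP[/negP + /negP]; rewrite -!ltnNge.
set u := m i; set v := m j => ua vb.
have Pp : prime_ideal P by apply: var_ideal_prime.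
have A0 : A 0 by rewrite -tofrac0; apply: localize_tofrac.
have AT f : A (tofrac f) by apply: localize_tofrac.
have AM x y : A x -> A y -> A (x * y) by apply: localizeM.
have AD x y : A x -> A y -> A (x + y) by apply: localizeD.
have AN x : A x -> A (- x) by apply: localizeTN.
have eF k : (k \in F) = (k == i) || (k == j) by rewrite finset.in_set2.
have [w' Fw' Tuv] : loc F T (U_(i) *+ u + U_(j) *+ v)%MM.
  apply: loc_eq_on locm => // k; rewrite eF mnmDE !mulmnE !mnm1E.
  case/orP=> /eqP->; rewrite eqxx ?(negbTE ij) 1?eq_sym ?(negbTE ij) /u /v; lia.
(* A common multiplier, invertible in the localization, moves both monomials into the ideal
   itself. *)
pose W := (w + w')%MM.
have FW : ~ meets F W by apply: meets_add.
pose p0 := (U_(i) *+ a + W)%MM; pose p1 := (U_(i) *+ u + U_(j) *+ v + W)%MM.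
have T0 : mon_ideal T ('X_[p0] : S).
  apply/mon_idealX; apply: Tup Ta; apply/mnm_lepP => k; rewrite !mnmE; lia.
have T1 : mon_ideal T ('X_[p1] : S).
  apply/mon_idealX; apply: Tup Tuv; apply/mnm_lepP => k; rewrite !mnmE; lia.
have rel : tofrac 'X_[U_(j) *+ v] * tofrac 'X_[p0] =
           tofrac 'X_[U_(i) *+ (a - u)] * tofrac ('X_[p1] : S).
  rewrite -!tofracM -!mpolyXD; congr (tofrac 'X_[_]).
  apply/mnmP => k; rewrite !mnmE !mulmnE.
  have := subnK (ltnW ua); move: (a - u)%N => d <-; rewrite mulnDr; lia.
have := localize_tofrac Pp T0; rewrite eJ => /(span_over_seq A0 AD)[al Aal eal].
have := localize_tofrac Pp T1; rewrite eJ => /(span_over_seq A0 AD)[be Abe ebe].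
have Jc k : (k < size s)%N -> localize P (mon_ideal T)
    (tofrac 'X_[U_(j) *+ v] * al k - tofrac 'X_[U_(i) *+ (a - u)] * be k).
  move=> ks; rewrite eJ -[X in [set` X]]take_size.
  apply: (regular_sequence_syzygy A0 AD AN AM reg (c := fun k =>
    tofrac 'X_[U_(j) *+ v] * al k - tofrac 'X_[U_(i) *+ (a - u)] * be k)) => //.
    by move=> l; apply: AD; [|apply: AN]; apply: AM.
  under eq_bigr do rewrite mulrBl -!mulrA.
  by rewrite sumrB -!mulr_sumr -eal -ebe rel subrr.
(* Were all [al k] in [P R_P], the monomial [p0] would lie in the localization of [P] times the
   ideal. The factor from [P] can only take away [x_i], so the exponent [a - 1] would already
   suffice, against [amin]. *)
have [k ks alk] : exists2 k, (k < size s)%N & ~ localize P P (al k).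
  apply: contrapT => h.
  have : localize P (mon_ideal (mon_add (meets F) T)) (tofrac ('X_[p0] : S)).
    rewrite eal; apply: (big_ind (localize P _)).
    - rewrite -tofrac0; apply: localize_tofrac => //; exact: mon_ideal0.
    - move=> x y; apply: localizeD => //; first by move=> f g; apply: mon_idealD.
      by move=> f g; apply: mon_idealMl; apply: upclosed_add; apply: upclosed_meets.
    - move=> k _; apply: (localizeM Pp (L := P) (L' := mon_ideal T)).
      + by move=> f g; apply: mon_idealM.
      + by apply: contrapT => nk; apply: h; exists k.
      + rewrite eJ -[s`_k]mul1r; apply: span_overM; last exact: mem_nth.
        by rewrite -tofrac1.
  move=> /localize_monX [w2 Fw2 [p [l lF pl] [q Tq epq]]].
  have pq x : (p x + q x = (i == x) * a + (w x + w' x) + w2 x)%N.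
    by move/mnmP/(_ x): epq; rewrite !mnmE mulmnE mnm1E.
  move/meetsPn in Fw; move/meetsPn in Fw'; move/meetsPn in Fw2.
  have li : l = i.
    move: lF (pq l); rewrite eF => /orP[/eqP//|/eqP lj]; move: pl.
    by rewrite lj (negbTE ij) Fw ?Fw' ?Fw2 ?eF ?eqxx ?orbT //; lia.
  have /amin : loc F T (U_(i) *+ a.-1)%MM; last by lia.
  exists (W + w2)%MM; first by apply: meets_add => //; apply/meetsPn.
  apply: Tup Tq; apply/mnm_lepP => x; rewrite !mnmE mulmnE mnm1E.
  have := pq x; case: (eqVneq i x) => [ix|_]; last by lia.
  by move: pl; rewrite li -ix; lia.
have [aln0 Aali] := localize_unit Pp (Aal k) alk.
(* Enlarging the ideal by [x_i] absorbs the term with [be k], because [u < a]. *)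
pose T' := T `|` meets [set i]%SET.
have T'up : upclosed T'.
  by move=> p q le [Tp|mp]; [left; apply: Tup Tp|right; apply: upclosed_meets mp].
have : localize P (mon_ideal T') (tofrac ('X_[U_(j) *+ v] : S)).
  rewrite -[X in localize _ _ X](mulfK aln0) mulrC.
  rewrite -[_ * al k](subrK (tofrac 'X_[U_(i) *+ (a - u)] * be k)).
  apply: (localizeM Pp (L := setT) (L' := mon_ideal T')) => //.
    by move=> f g _; apply: mon_idealMl.
  apply: localizeD => //.
  - by move=> f g; apply: mon_idealD.
  - by move=> f g; apply: mon_idealMl.
  - by apply: localize_sub (Jc k ks); apply: mon_ideal_le => p; left.
  rewrite mulrC; apply: (localizeM Pp (L := setT) (L' := mon_ideal T')) (Abe k) _.
    by move=> f g _; apply: mon_idealMl.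
  apply: localize_tofrac => //; apply/mon_idealX; right; exists i; first by rewrite finset.in_set1.
  by rewrite mulmnE mnm1E eqxx; lia.
move=> /localize_monX [w2 Fw2 [Tv|[l]]].
  by have /bmin : loc F T (U_(j) *+ v)%MM by [exists w2]; lia.
move/meetsPn in Fw2.
rewrite finset.in_set1 => /eqP->; rewrite mnmDE mulmnE mnm1E (eq_sym j) (negbTE ij) Fw2 //.
by rewrite eF eqxx.
Qed.

End TwoVariables.

(** * The exponent matrix of the ideal *)

Section Structure.
Variables (K : fieldType) (n : nat).
Local Notation S := {mpoly K[n]}.
Implicit Types (F : {set 'I_n}) (T : set 'X_{1..n}) (m : 'X_{1..n}).
Implicit Types (a : 'I_n -> 'I_n -> nat).

Definition pair_exponents (i j : 'I_n) (a b : nat) : set 'X_{1..n} :=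
  [set m | (a <= m i)%N \/ (b <= m j)%N].

Definition graph_exponents a : set 'X_{1..n} :=
  [set m | forall i j, i != j -> pair_exponents i j (a i j) (a j i) m].

Lemma le_mulm1 i (u : nat) m : (U_(i) *+ u <= m)%MM = (u <= m i)%N.
Proof.
apply/mnm_lepP/idP => [/(_ i)|um k]; rewrite mulmnE mnm1E ?eqxx ?mul1n //.
by case: eqP => [<-|_]; rewrite ?mul1n.
Qed.

Lemma var_ideal_chain2_gt1 F : prime_chain (var_ideal F : set S) 2 -> (1 < #|F|)%N.
Proof.
rewrite ltnNge => ch; apply/negP => F1; have [F0|[i iF]] := set_0Vmem F.
  case: ch => [Q [Qp Qlt Q2]]; have [[Q0 _ _] _] := Qp 1%N isT.
  have [_ []] := Qlt 1%N isT; rewrite Q2 F0 => f hf; rewrite inE in Q0.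
  suff -> : f = 0 by [].
  apply: msuppnil0; case e: (msupp f) => [|m s] //.
  by have [|i] := hf m; rewrite ?finset.in_set0 // e mem_head.
apply: (@var_ideal1_nochain2 _ _ i F) ch.
by apply/fintype.subsetP => j jF; rewrite finset.in_set1 (card_le1_eqP F1 i j).
Qed.

Lemma unmixed2_card T F : unmixed (mon_ideal T : set S) 2 ->
  associated_prime (mon_ideal T : set S) (var_ideal F : set S) -> #|F| = 2%N.
Proof.
move=> unm /unm[c2 c3]; apply/eqP; rewrite eqn_leq var_ideal_chain2_gt1 // andbT.
by rewrite leqNgt; apply/negP => /var_ideal_chain3.
Qed.

(** A smaller prime over the ideal ends a chain of length 2, which would extend to one of length 3
    ending at an associated prime. *)
Lemma unmixed_minimal_prime T F : has_height (mon_ideal T : set S) 2 ->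
    unmixed (mon_ideal T : set S) 2 -> upclosed T -> ~ loc F T 0%MM ->
    associated_prime (mon_ideal T : set S) (var_ideal F : set S) ->
  minimal_prime (mon_ideal T : set S) (var_ideal F : set S).
Proof.
move=> [ht _] unm Tup l0 ass; split; first exact: var_ideal_prime.
  by apply: mon_ideal_le; apply: sub_meets.
move=> Q Qp TQ QF; apply: contrapT => QnF; have [_ []] := unm _ ass.
apply: prime_chain_extend (ht Q Qp TQ) (var_ideal_prime K F) _.
split=> // FQ; apply: QnF; exact/seteqP.
Qed.

(** Otherwise the localization at [(x_j)] is proper, which produces an associated prime with at most
    one variable. *)
Lemma pure_power_loc T i j : unmixed (mon_ideal T : set S) 2 -> upclosed T ->
  i != j -> exists u, loc [set i; j]%SET T (U_(i) *+ u)%MM.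
Proof.
move=> unm Tup ij; apply: contrapT => h.
have l0 : ~ loc [set j]%SET T 0%MM.
  case=> w /meetsPn wj; rewrite add0m => Tw; apply: h; exists (w i).
  apply: (@loc_eq_on _ _ T w) => //; last exact: sub_loc.
  move=> k; rewrite finset.in_set2 => /orP[]/eqP->; rewrite mulmnE mnm1E.
    by rewrite eqxx mul1n.
  by rewrite (negbTE ij) wj ?finset.in_set1.
have [F [Fj _ ass]] := @associated_var_ideal K _ _ T _ Tup l0.
by move: (subset_leq_card Fj); rewrite (unmixed2_card unm ass) cards1.
Qed.

(** For [i != j], [a i j] is the least [u] such that [x_i^u] enters the localization at
    [(x_i, x_j)]. It vanishes exactly when this localization is the unit ideal, which is symmetric
    in [i] and [j]. *)
Lemma unmixed_gci_exponents T : upclosed T ->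
    has_height (mon_ideal T : set S) 2 -> unmixed (mon_ideal T : set S) 2 ->
    generically_complete_intersection (mon_ideal T : set S) ->
  exists a, [/\ forall i, a i i = 0%N, forall i j, a i j = 0%N -> a j i = 0%N &
    T = graph_exponents a].
Proof.
move=> Tup ht unm gci.
pose minexp (e : 'I_n * 'I_n) u :=
  let l u := loc [set e.1; e.2]%SET T (U_(e.1) *+ u)%MM in
  if e.1 == e.2 then u = 0%N else l u /\ forall u', l u' -> (u <= u')%N.
have [a ha] : {a : 'I_n * 'I_n -> nat & forall e, minexp e (a e)}.
  apply: (@choice _ _ minexp) => -[i j]; rewrite /minexp /=.
  case: eqVneq => [_|ij]; first by exists 0%N.
  have [u lu] := pure_power_loc unm Tup ij.
  have ex : exists u, `[< loc [set i; j]%SET T (U_(i) *+ u)%MM >].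
    by exists u; apply/asboolP.
  case: (ex_minnP ex) => v /asboolP lv vmin; exists v; split=> // u' lu'.
  by apply: vmin; apply/asboolP.
have {}ha i j : i != j -> loc [set i; j]%SET T (U_(i) *+ a (i, j))%MM /\
    forall u, loc [set i; j]%SET T (U_(i) *+ u)%MM -> (a (i, j) <= u)%N.
  by move=> ij; have := ha (i, j); rewrite /minexp /= (negbTE ij).
have a0 i j : i != j -> (loc [set i; j]%SET T 0%MM <-> a (i, j) = 0%N).
  move=> /ha[la amin]; split=> [l0|e]; last by rewrite e mulm0n in la.
  by apply/eqP; rewrite -leqn0; apply: amin; rewrite mulm0n.
exists (fun i j => if i == j then 0%N else a (i, j)); split=> [i|i j|].
- by rewrite eqxx.
- rewrite (eq_sym j); case: eqVneq => // ij /(a0 _ _ ij).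
  by rewrite finset.setUC => /a0; apply; rewrite eq_sym.
apply/seteqP; split=> m Tm.
  move=> i j ij; rewrite /pair_exponents /= (eq_sym j) (negbTE ij).
  have [/(a0 _ _ ij) -> |l0] := pselect (loc [set i; j]%SET T 0%MM); first by left.
  (* Unmixedness rules out a smaller [F], so [(x_i, x_j)] is associated, hence minimal, and the
     complete intersection hypothesis applies to it. *)
  have [F [Fij lF ass]] := @associated_var_ideal K _ _ T _ Tup l0.
  have eF : F = [set i; j]%SET.
    by apply/eqP; rewrite eqEcard Fij (unmixed2_card unm ass) cards2 ij.
  have := gci _ (unmixed_minimal_prime ht unm Tup lF ass); rewrite eF => ci.
  have [lai amini] := ha i j ij.
  have [laj aminj] : _ /\ _ := ha j i (contra_neq (@esym _ _ _) ij).
  apply: (complete_intersection_exponents Tup ij ci lai amini) => //.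
    by rewrite finset.setUC.
  exact: sub_loc.
apply: contrapT; rewrite -[T]loc_setT => lm.
have [F [_ lF ass]] := @associated_var_ideal K _ _ T _ Tup lm.
have /eqP/cards2P[i [j [ij eF]]] := unmixed2_card unm ass.
apply: lF; rewrite eF in ass *.
have := Tm i j ij; rewrite /pair_exponents /= (eq_sym j) (negbTE ij).
have ji : j != i by rewrite eq_sym.
rewrite -!le_mulm1; case; [have [la _] := ha i j ij|have [la _] := ha j i ji].
  by move=> le; apply: upclosed_loc le la.
by rewrite finset.setUC => le; apply: upclosed_loc le la.
Qed.

End Structure.

(** * Irreducible components and symbolic powers *)

Section SymbolicPowers.
Variables (K : fieldType) (n : nat).
Local Notation S := {mpoly K[n]}.
Implicit Types (T U : set 'X_{1..n}) (m : 'X_{1..n}) (a : 'I_n -> 'I_n -> nat).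
Implicit Types (C I : set S) (D : set (set S)).

Definition irreducible_exponents (b : 'I_n -> nat) : set 'X_{1..n} :=
  [set m | exists2 i, (0 < b i)%N & (b i <= m i)%N].

Lemma upclosed_irreducible b : upclosed (irreducible_exponents b).
Proof.
by move=> m m' /mnm_lepP le [i bi bm]; exists i => //; apply: leq_trans (le i).
Qed.

Lemma irreducible_monomial_idealP C : irreducible_monomial_ideal C ->
  exists b, C = mon_ideal (irreducible_exponents b).
Proof.
case=> b ->; exists b; apply: ideal_gen_mon; first exact: upclosed_irreducible.
  move=> _ [i /= bi <-]; rewrite mpolyXn; apply/mon_idealX; exists i => //.
  by rewrite mulmnE mnm1E eqxx mul1n.
move=> m [i bi bm]; rewrite -(submK (m := U_(i) *+ b i) (m' := m)) ?le_mulm1 //.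
by rewrite mpolyXD; apply: span_overM => //; exists i; rewrite // mpolyXn.
Qed.

Lemma upclosed_pair (i j : 'I_n) (a b : nat) : upclosed (pair_exponents i j a b).
Proof.
by move=> m m' /mnm_lepP le [l|l]; [left|right]; apply: leq_trans (le _).
Qed.

Lemma power_ideal2_mon (i j : 'I_n) (a b : nat) :
  power_ideal2 i j a b = mon_ideal (pair_exponents i j a b) :> set S.
Proof.
apply: ideal_gen_mon.
- exact: upclosed_pair.
- by move=> _ [|] -> ; rewrite mpolyXn; apply/mon_idealX; [left|right];
    rewrite mulmnE mnm1E eqxx mul1n.
- by move=> m [|]; rewrite -le_mulm1 => /submK <-; rewrite mpolyXD;
    apply: span_overM => //; rewrite -mpolyXn; [left|right].
Qed.

Lemma irreducible_power_ideal2 (i j : 'I_n) (a b : nat) : i != j ->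
  (0 < a)%N -> (0 < b)%N -> irreducible_monomial_ideal (power_ideal2 i j a b : set S).
Proof.
move=> ij a0 b0; exists (fun k => if k == i then a else if k == j then b else 0%N).
have ji := ij; rewrite eq_sym in ji.
congr ideal_gen; apply/seteqP; split=> [f [|] ->|f [k /=]].
- by exists i; rewrite /= eqxx.
- by exists j; rewrite /= (negbTE ji) eqxx.
- by do 2?case: eqP => [->|_] // ; move=> _ <-; [left|right].
Qed.

(* The complement of [irreducible_exponents b] is closed under lcm. *)
Lemma irreducible_contains_factor (s : seq (set S)) C :
    irreducible_monomial_ideal C ->
    (forall C', C' \in s -> irreducible_monomial_ideal C') ->
    \bigcap_(C' in [set` s]) C' `<=` C ->
  exists2 C', C' \in s & C' `<=` C.
Proof.
move=> /irreducible_monomial_idealP[b ->] irr sC; apply: contrapT => h.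
suff [m sm bm] : exists2 m, forall C', C' \in s -> C' 'X_[m] &
    ~ irreducible_exponents b m.
  by apply: bm; apply/(mon_idealX K); apply: sC => C' /sm.
have {}h C' : C' \in s -> ~ (C' `<=` mon_ideal (irreducible_exponents b)).
  by move=> Cs Cb; apply: h; exists C'.
elim: s irr h {sC} => [|C' s IH] irr h.
  by exists 0%MM => // -[i]; rewrite mnm0E; case: (b i).
have [|C'' Cs|m sm bm] := IH.
- by move=> C'' Cs; apply: irr; rewrite in_cons Cs orbT.
- by apply: h; rewrite in_cons Cs orbT.
have /irreducible_monomial_idealP[c eC] := irr C' (mem_head _ _).
have [q cq bq] : exists2 q, irreducible_exponents c q & ~ irreducible_exponents b q.
  apply: contrapT => nq; apply: (h C' (mem_head _ _)); rewrite eC.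
  apply: mon_ideal_le => q cq; apply: contrapT => bq; apply: nq; by exists q.
pose l := [multinom maxn (m i) (q i) | i < n]%MM.
have ml : (m <= l)%MM by apply/mnm_lepP => i; rewrite mnmE leq_maxl.
have ql : (q <= l)%MM by apply/mnm_lepP => i; rewrite mnmE leq_maxr.
exists l; last first.
  by case=> i bi; rewrite mnmE leq_max => /orP[?|?]; [apply: bm|apply: bq]; exists i.
move=> C''; rewrite in_cons => /orP[/eqP->|Cs].
  by rewrite eC; apply/mon_idealX; apply: upclosed_irreducible ql cq.
have [|c' eC''] := @irreducible_monomial_idealP C''.
  by apply: irr; rewrite in_cons Cs orbT.
have := sm _ Cs; rewrite eC''.
by move=> /mon_idealX cm; apply/mon_idealX; apply: upclosed_irreducible ml cm.
Qed.

(** [C] contains some [C'] of [D'], which contains some [C''] of [D]. Irredundancy forces [C'' = C],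
    so [C = C']. *)
Lemma irredundant_presentation_sub I D D' :
  irredundant_presentation I D -> irredundant_presentation I D' -> D `<=` D'.
Proof.
move=> [/finite_seqP[s ->] irr eI red] [/finite_seqP[s' ->] irr' eI' red'] C Cs.
have [|C' Cs' C'C] := irreducible_contains_factor (irr C Cs) irr'.
  by rewrite -eI' eI; apply: bigcap_inf.
have [|C'' Cs'' C''C'] := irreducible_contains_factor (irr' C' Cs') irr.
  by rewrite -eI eI'; apply: bigcap_inf.
have [eC|nC] := pselect (C'' = C).
  by rewrite eC in C''C'; have -> : C = C' by apply/seteqP.
case: (red C Cs); rewrite eI; apply/seteqP; split=> f hf E.
  by case=> Es _; apply: hf.
move=> Es; have [->|EC] := pselect (E = C); last by apply: hf.
by apply/C'C/C''C'; apply: hf.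
Qed.

Lemma irreducible_componentsE I D :
  irredundant_presentation I D -> irreducible_components I = D.
Proof.
move=> pD; apply: xget_unique => // D' pD'.
apply/seteqP; split; first exact: irredundant_presentation_sub pD.
exact: irredundant_presentation_sub pD'.
Qed.

Lemma ideal_of_exponents_mon a :
  (ideal_of_exponents a : set S) = mon_ideal (graph_exponents a).
Proof.
rewrite /ideal_of_exponents; under eq_bigcapr do rewrite power_ideal2_mon.
rewrite mon_ideal_bigcap; congr mon_ideal; apply/seteqP; split=> m hm.
  move=> i j; rewrite -val_eqE /= neq_ltn => /orP[ij|ji]; first exact: (hm (i, j)).
  by case: (hm (j, i) ji); [right|left].
move=> [i j] /= ij; apply: hm; by rewrite -val_eqE /= neq_ltn ij.
Qed.

Section Graph.
Variable a : 'I_n -> 'I_n -> nat.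
Hypothesis a0 : forall i j, a i j = 0%N -> a j i = 0%N.

Let E : set ('I_n * 'I_n) := [set e : 'I_n * 'I_n | (e.1 < e.2)%N /\ (0 < a e.1 e.2)%N].
Let Q (e : 'I_n * 'I_n) : set S := power_ideal2 e.1 e.2 (a e.1 e.2) (a e.2 e.1).

Let a_gt0 i j : (0 < a i j)%N -> (0 < a j i)%N.
Proof. by rewrite !lt0n; apply: contra_neq; apply: a0. Qed.

Let radicalX e k : E e -> radical (Q e) 'X_k <-> (k == e.1) || (k == e.2).
Proof.
case: e => i j [/= ij aij]; have aji := a_gt0 aij; rewrite /Q /= power_ideal2_mon; split.
  case=> N; rewrite mpolyXn => /mon_idealX[] /=; rewrite mulmnE mnm1E.
  1,2: by case: eqVneq => _; rewrite ?orbT // mul0n; lia.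
case/orP=> /eqP->; [exists (a i j)|exists (a j i)]; rewrite mpolyXn; apply/mon_idealX.
  by left; rewrite mulmnE mnm1E eqxx mul1n.
by right; rewrite mulmnE mnm1E eqxx mul1n.
Qed.

(** The variables in the radical recover the edge. Hence each primary component is a single
    irreducible component. *)
Let radical_inj e e' : E e -> E e' -> radical (Q e) = radical (Q e') -> e = e'.
Proof.
move=> Ee Ee' eQ.
have h k : (k == e.1) || (k == e.2) = (k == e'.1) || (k == e'.2).
  have := radicalX k Ee'; have := radicalX k Ee; rewrite eQ => h h'.
  by apply/idP/idP => [/h/h'|/h'/h].
move: Ee Ee' h => [+ _] [+ _] {eQ}; case: e => i j; case: e' => i' j' /= lt lt' h.
have := h i; have := h j; rewrite !eqxx orbT /= => /esym/orP ej /esym/orP ei.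
by case: ei ej lt lt' => /eqP-> [] /eqP-> lt lt' //; exfalso; lia.
Qed.

Lemma graph_irredundant :
  irredundant_presentation (ideal_of_exponents a : set S) (Q @` E).
Proof.
split.
- exact/finite_image/finite_finset.
- move=> _ [[i j] [/= ij aij] <-]; apply: irreducible_power_ideal2 => //; last exact: a_gt0.
  by rewrite -val_eqE /= ltn_eqF.
- apply/seteqP; split=> f hf; first by move=> _ [e [lt _] <-]; apply: hf.
  move=> e lt; have [ae|] := posnP (a e.1 e.2); last by move=> ae; apply: hf; exists e.
  rewrite power_ideal2_mon => m _; left; by rewrite ae.
move=> _ [[i j] [/= ij aij] <-].
set X := \bigcap_(_ in _) _; suff [m Xm im] : exists2 m, X 'X_[m] & ~ Q (i, j) 'X_[m].
  by move=> eX; rewrite -eX in Xm; apply: im; apply: Xm.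
have aji := a_gt0 aij.
(* Zero at both ends of this edge and above all thresholds elsewhere: every other edge has an end
   elsewhere. *)
exists [multinom if (k == i) || (k == j) then 0%N else (\sum_l a k l)%N | k < n].
  move=> _ [[[i' j'] [/= ij' aij'] <-] ne]; rewrite /Q /= power_ideal2_mon.
  have aji' := a_gt0 aij'.
  have le k l : (a k l <= \sum_l' a k l')%N by rewrite (bigD1 l) //= leq_addr.
  apply/mon_idealX; rewrite /pair_exponents /= !mnmE.
  case: ifP => hi; last by left.
  case: ifP => hj; last by right.
  case: ne; congr Q.
  by case/orP: hi ij ij' => /eqP->; case/orP: hj => /eqP-> // *; exfalso; lia.
rewrite /Q power_ideal2_mon => /mon_idealX[] /=; rewrite mnmE ?eqxx ?orbT leqn0 => /eqP e.
  by rewrite e in aij.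
by rewrite e in aji.
Qed.

Lemma symbolic_power_graph k :
  symbolic_power (ideal_of_exponents a : set S) k =
  \bigcap_(e in E) ideal_pow (Q e) k.
Proof.
rewrite /symbolic_power /primary_component (irreducible_componentsE graph_irredundant).
have prim e : E e ->
    \bigcap_(C in [set C | (Q @` E) C /\ radical C = radical (Q e)]) C = Q e.
  move=> Ee; apply/seteqP; split=> f hf; first by apply: hf; split=> //; exists e.
  by move=> _ [[e' Ee' <-] /radical_inj ->].
apply/seteqP; split=> f hf.
  move=> e Ee; rewrite -(prim e Ee); apply: hf; exists (Q e) => //; by exists e.
by move=> _ [_ [e Ee <-] <-]; rewrite prim //; apply: hf.
Qed.

End Graph.

(** The quotients count the powers of each generator dividing the monomial; splitting off a
    generator lowers one of them by one. *)
Lemma mon_pow_pair (i j : 'I_n) (a b k : nat) :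
    i != j -> (0 < a)%N -> (0 < b)%N ->
  mon_pow (pair_exponents i j a b) k = [set m | (k <= m i %/ a + m j %/ b)%N].
Proof.
move=> ij a0 b0; have ji : j != i by rewrite eq_sym.
elim: k => [|k IH]; first by apply/seteqP; split.
rewrite /mon_pow iterS -/(mon_pow _ k) IH; apply/seteqP; split=> m.
  case=> p hp [q /= kq <-]; rewrite !mnmE.
  have divS (c x y : nat) : (0 < c -> c <= x -> (y %/ c).+1 <= (x + y) %/ c)%N.
    by move=> c0 cx; rewrite -addn1 addnC -divnMDl // mul1n leq_div2r // leq_add2r.
  have divD (c x y : nat) : (y %/ c <= (x + y) %/ c)%N by rewrite leq_div2r // leq_addl.
  case: hp => hp.
    by have := divS _ _ (q i) a0 hp; have := divD b (p j) (q j); lia.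
  by have := divS _ _ (q j) b0 hp; have := divD a (p i) (q i); lia.
have divB (c x : nat) : (0 < c -> c <= x -> x %/ c = ((x - c) %/ c).+1)%N.
  by move=> c0 cx; rewrite -{1}(subnKC cx) -{1}[c]mul1n divnMDl.
rewrite /= => km; have [am|ma] := leqP a (m i).
  exists (U_(i) *+ a)%MM; first by left; rewrite mulmnE mnm1E eqxx mul1n.
  exists (m - U_(i) *+ a)%MM; last by rewrite addmC submK ?le_mulm1.
  rewrite /= !mnmE !mulmnE !mnm1E eqxx (negbTE ij) mul1n mul0n subn0.
  by move: km; rewrite (divB a (m i)) // addSn.
have bm : (b <= m j)%N.
  by move: km; rewrite divn_small //; apply: contraLR; rewrite -!ltnNge => /divn_small ->.
exists (U_(j) *+ b)%MM; first by right; rewrite mulmnE mnm1E eqxx mul1n.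
exists (m - U_(j) *+ b)%MM; last by rewrite addmC submK ?le_mulm1.
rewrite /= !mnmE !mulmnE !mnm1E eqxx (negbTE ji) mul1n mul0n subn0.
by move: km; rewrite (divB b (m j)) // addnS.
Qed.

End SymbolicPowers.

(** * Two-covers of triangles and paths *)

Section TwoCovers.
Local Open Scope nat_scope.

(** One disjunct per generator of the square of [(x^a, y^b)]. Avoiding division suits linear
    arithmetic, and zero thresholds, standing for a missing edge, make it true. *)
Definition two_cover (a b x y : nat) : bool :=
  [|| a + a <= x, (a <= x) && (b <= y) | b + b <= y].

Lemma two_cover_div a b x y : 0 < a -> 0 < b ->
  two_cover a b x y -> 2 <= x %/ a + y %/ b.
Proof.
move=> a0 b0; case/or3P => [h|/andP[h h']|h].
- by rewrite (leq_trans _ (leq_addr _ _)) // leq_divRL // mul2n -addnn.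
- by apply: (@leq_add 1 1); rewrite leq_divRL // mul1n.
- by rewrite (leq_trans _ (leq_addl _ _)) // leq_divRL // mul2n -addnn.
Qed.

(** Membership of the monomial with exponents [x], [y], [z] in the square of the ideal of the
    triangle. *)
Definition splits_triangle (a b c d e f x y z : nat) : Prop :=
  exists p1 p2 p3 q1 q2 q3,
  [/\ p1 + q1 <= x, p2 + q2 <= y & p3 + q3 <= z] /\
  [&& (a <= p1) || (c <= p2), (b <= p1) || (d <= p3), (e <= p2) || (f <= p3),
      (a <= q1) || (c <= q2), (b <= q1) || (d <= q3) & (e <= q2) || (f <= q3)].

(* The edges of the triangle carry the thresholds 12 : (a, c), 13 : (b, d) and
   23 : (e, f). *)
Definition triangle_normal (a b c d e f : nat) : Prop := forall x y z,
  two_cover a c x y -> two_cover b d x z -> two_cover e f y z ->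
  splits_triangle a b c d e f x y z.

(** Together with [triangle_rotate] this generates all relabelings of the three vertices. *)
Lemma triangle_swap a b c d e f :
  triangle_normal a b c d e f -> triangle_normal c e a f b d.
Proof.
move=> h x y z h1 h2 h3; have [] := h y x z.
- by move: h1; rewrite /two_cover; lia.
- exact: h3.
- exact: h2.
move=> p1 [p2 [p3 [q1 [q2 [q3 [[? ? ?] hp]]]]]].
by exists p2, p1, p3, q2, q1, q3; split=> //; lia.
Qed.

Lemma triangle_rotate a b c d e f :
  triangle_normal a b c d e f -> triangle_normal e c f a d b.
Proof.
move=> h x y z h1 h2 h3; have [] := h z x y.
- by move: h2; rewrite /two_cover; lia.
- by move: h3; rewrite /two_cover; lia.
- exact: h1.
move=> p1 [p2 [p3 [q1 [q2 [q3 [[? ? ?] hp]]]]]].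
by exists p2, p3, p1, q2, q3, q1; split=> //; lia.
Qed.

(** The exponent [d] at vertex 3 serves at most one factor. Another factor needs [b] at vertex 1 and
    [e] at vertex 2, which leaves less than [a] and less than [c] there, so edge 12 fails. *)
Lemma triangle_cyclic a b c d e f : 0 < a -> 0 < c -> 0 < d -> 0 < e ->
  triangle_normal a b c d e f -> a < b -> e < c -> d <= f -> False.
Proof.
move=> a0 c0 d0 e0 h ab ec df.
have [|||p1 [p2 [p3 [q1 [q2 [q3 [[? ? ?] hp]]]]]]] :=
  h (maxn (a + a) b) (maxn (e + e) c) d; rewrite /two_cover; lia.
Qed.

(** With exponents [b], [c], [d], vertices 2 and 3 each serve at most one factor, and edge 23 makes
    these factors different. Edge 13 then spends vertex 1 on the factor of vertex 2, and the other
    factor misses edge 12. *)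
Lemma triangle_cyclic_eq a b c d e f : 0 < a -> 0 < c -> 0 < d ->
  triangle_normal a b c d e f -> a <= b -> c = e -> d = f -> False.
Proof.
move=> a0 c0 d0 h ab ce df; rewrite -{}ce -{}df in h.
have [|||p1 [p2 [p3 [q1 [q2 [q3 [[? ? ?] hp]]]]]]] := h b c d; rewrite /two_cover; lia.
Qed.

(** Here edge 12 has the larger threshold at both its ends. Ties at vertices 2 and 3 need their own
    exponents; the strict case fails as in [triangle_cyclic]. *)
Lemma triangle_acyclic a b c d e f :
    0 < a -> 0 < b -> 0 < c -> 0 < d -> 0 < e -> 0 < f ->
  triangle_normal a b c d e f -> b <= a -> e <= c -> d <= f -> False.
Proof.
move=> a0 b0 c0 d0 e0 f0 h ba ec df.
have [ce|ce] := eqVneq c e.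
  have [|||p1 [p2 [p3 [q1 [q2 [q3 [[? ? ?] hp]]]]]]] := h a c f; rewrite /two_cover; lia.
have [de|de] := eqVneq d f.
  have [|||p1 [p2 [p3 [q1 [q2 [q3 [[? ? ?] hp]]]]]]] := h a c d; rewrite /two_cover; lia.
have [|||p1 [p2 [p3 [q1 [q2 [q3 [[? ? ?] hp]]]]]]] :=
  h a (maxn c (e + e)) d; rewrite /two_cover; lia.
Qed.

(** At least two of the three inequalities are strict, or at least two are equalities; a rotation
    brings them into the position required above. *)
Lemma triangle_oriented a b c d e f :
    0 < a -> 0 < b -> 0 < c -> 0 < d -> 0 < e -> 0 < f ->
  triangle_normal a b c d e f -> a <= b -> e <= c -> d <= f -> False.
Proof.
move=> a0 b0 c0 d0 e0 f0 h ab ec df.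
have h1 := triangle_rotate h; have h2 := triangle_rotate h1.
have := triangle_cyclic a0 c0 d0 e0 h.
have := triangle_cyclic e0 f0 a0 d0 h1.
have := triangle_cyclic d0 b0 e0 a0 h2.
have := triangle_cyclic_eq a0 c0 d0 h.
have := triangle_cyclic_eq e0 f0 a0 h1.
have := triangle_cyclic_eq d0 b0 e0 h2.
lia.
Qed.

(** Each vertex selects its edge of larger threshold. Of the eight selections two are cyclic, and in
    the other six some edge is selected from both ends. *)
Lemma triangle_not_normal a b c d e f :
    0 < a -> 0 < b -> 0 < c -> 0 < d -> 0 < e -> 0 < f ->
  ~ triangle_normal a b c d e f.
Proof.
move=> a0 b0 c0 d0 e0 f0 h.
have h1 := triangle_rotate h; have h2 := triangle_rotate h1.
have g := triangle_swap h; have g1 := triangle_rotate g; have g2 := triangle_rotate g1.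
have := triangle_oriented a0 b0 c0 d0 e0 f0 h.
have := triangle_oriented c0 e0 a0 f0 b0 d0 g.
have := triangle_acyclic a0 b0 c0 d0 e0 f0 h.
have := triangle_acyclic e0 c0 f0 a0 d0 b0 h1.
have := triangle_acyclic d0 f0 b0 e0 a0 c0 h2.
have := triangle_acyclic c0 e0 a0 f0 b0 d0 g.
have := triangle_acyclic b0 a0 d0 c0 f0 e0 g1.
have := triangle_acyclic f0 d0 e0 b0 c0 a0 g2.
lia.
Qed.

(** Exponent 0 at vertex 2 forces both factors to take [a] at vertex 1, and [d] at vertex 3 serves
    only one, so the other takes [b]; if [a < b], then [a + b] exceeds [maxn (a + a) b]. *)
Lemma path_le a b c d : 0 < a -> 0 < c -> 0 < d ->
  triangle_normal a b c d 0 0 -> b <= a.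
Proof.
move=> a0 c0 d0 h; rewrite leqNgt; apply/negP => ab.
have [|||p1 [p2 [p3 [q1 [q2 [q3 [[? ? ?] hp]]]]]]] := h (maxn (a + a) b) 0 d;
  rewrite /two_cover; lia.
Qed.

End TwoCovers.

(** * Consequences of equality for the second powers *)

Section NormalGraphs.
Variables (n : nat) (a : 'I_n -> 'I_n -> nat).
Hypotheses (adiag : forall i, a i i = 0%N) (a0 : forall i j, a i j = 0%N -> a j i = 0%N).
Local Open Scope nat_scope.

Definition symbolic_exponents k : set 'X_{1..n} :=
  [set m | forall i j, 0 < a i j -> k <= m i %/ a i j + m j %/ a j i].

Lemma upclosed_graph : upclosed (graph_exponents a).
Proof. by move=> m m' le hm i j ij; apply: upclosed_pair le (hm i j ij). Qed.

Lemma edge_sym i j : 0 < a i j -> 0 < a j i.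
Proof. by rewrite !lt0n; apply: contra_neq; apply: a0. Qed.

Lemma edge_neq i j : 0 < a i j -> i != j.
Proof. by apply: contraTneq => ->; rewrite adiag. Qed.

Lemma mon_pow_sub_symbolic k : mon_pow (graph_exponents a) k `<=` symbolic_exponents k.
Proof.
move=> m hm i j aij; suff : mon_pow (pair_exponents i j (a i j) (a j i)) k m.
  by rewrite mon_pow_pair // ?edge_neq //; apply: edge_sym.
elim: k m hm => [//|k IH] m [p hp [q hq <-]].
exists p; first by apply: hp; apply: edge_neq.
by exists q => //; apply: IH.
Qed.

Hypothesis normal2 : symbolic_exponents 2 `<=` mon_pow (graph_exponents a) 2.

Lemma normal_splits m : symbolic_exponents 2 m -> exists p q,
  [/\ graph_exponents a p, graph_exponents a q & forall i, p i + q i <= m i].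
Proof. by move/normal2; apply: mon_pow2; apply: upclosed_graph. Qed.

(* Large exponents outside [i, j, k] satisfy all the other edges. *)
Lemma normal_triangle i j k : i != j -> i != k -> j != k ->
  triangle_normal (a i j) (a i k) (a j i) (a k i) (a j k) (a k j).
Proof.
move=> ij ik jk x y z h1 h2 h3.
have ji := ij; rewrite eq_sym in ji; have ki := ik; rewrite eq_sym in ki.
have kj := jk; rewrite eq_sym in kj.
pose m := [multinom if l == i then x else if l == j then y else
  if l == k then z else 2 * \sum_l' a l l' | l < n]%MM.
have mi : m i = x by rewrite mnmE eqxx.
have mj : m j = y by rewrite mnmE (negbTE ji) eqxx.
have mk : m k = z by rewrite mnmE (negbTE ki) (negbTE kj) eqxx.
have cover2C b c u v : two_cover b c u v -> two_cover c b v u.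
  by rewrite /two_cover; lia.
have big u v : u \notin [:: i; j; k] -> 0 < a u v -> 2 <= m u %/ a u v.
  rewrite !inE !negb_or => /and3P[ui uj uk] auv.
  rewrite mnmE (negbTE ui) (negbTE uj) (negbTE uk) leq_divRL // leq_mul2l /=.
  by rewrite (bigD1 v) //= leq_addr.
have small u v : u \in [:: i; j; k] -> v \in [:: i; j; k] -> 0 < a u v ->
    two_cover (a u v) (a v u) (m u) (m v).
  rewrite !inE => /or3P[]/eqP-> /or3P[]/eqP->;
    rewrite ?adiag // ?mi ?mj ?mk => _ //; exact: cover2C.
have [|p [q [hp hq pq]]] := @normal_splits m.
  move=> u v auv; have [us|/big us] := boolP (u \in [:: i; j; k]); last first.
    by apply: leq_trans (us _ auv) (leq_addr _ _).
  have [vs|/big vs] := boolP (v \in [:: i; j; k]); last first.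
    by apply: leq_trans (vs _ (edge_sym auv)) (leq_addl _ _).
  by apply: two_cover_div; [|exact: edge_sym|exact: small].
exists (p i), (p j), (p k), (q i), (q j), (q k).
rewrite -mi -mj -mk; split=> //; apply/and5P; split; last (apply/andP; split).
all: by [case: (hp _ _ ij) => ->; rewrite ?orbT|case: (hp _ _ ik) => ->; rewrite ?orbT|
  case: (hp _ _ jk) => ->; rewrite ?orbT|case: (hq _ _ ij) => ->; rewrite ?orbT|
  case: (hq _ _ ik) => ->; rewrite ?orbT|case: (hq _ _ jk) => ->; rewrite ?orbT].
Qed.

(** Two edges at [i] either close up to an excluded triangle or form a path, to which [path_le]
    applies in both directions. *)
Lemma normal_edge_weight i j k : 0 < a i j -> 0 < a i k -> a i j = a i k.
Proof.
have le j' k' : 0 < a i j' -> 0 < a i k' -> a i k' <= a i j'.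
  move=> aij aik; have [->//|jk] := eqVneq j' k'.
  have tri := normal_triangle (edge_neq aij) (edge_neq aik) jk.
  have [e|ajk] := posnP (a j' k'); last first.
    by case: (triangle_not_normal _ _ _ _ _ _ tri) => //; apply: edge_sym.
  rewrite e (a0 e) in tri.
  by apply: path_le tri => //; apply: edge_sym.
by move=> aij aik; apply/eqP; rewrite eqn_leq !le.
Qed.

Definition edge_weight i := \max_j a i j.

Lemma edge_weightE i j : 0 < a i j -> a i j = edge_weight i.
Proof.
move=> aij; apply/eqP; rewrite eqn_leq leq_bigmax /=; apply/bigmax_leqP => k _.
by have [->//|aik] := posnP (a i k); rewrite (normal_edge_weight aij aik).
Qed.

Lemma normal_bipartite : bipartite (fun i j => 0 < a i j).
Proof.
(* Every end of an edge has quotient 1, so this is a 2-cover. A non-isolated vertex has full weight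
   in at most one of [p] and [q], hence each edge has exactly one end of full weight in [p]. *)
have [|p [q [hp hq pq]]] := @normal_splits [multinom edge_weight i | i < n]%MM.
  move=> i j aij; have aji := edge_sym aij.
  by rewrite !mnmE -(edge_weightE aij) -(edge_weightE aji) !divnn aij aji.
exists [set i | edge_weight i <= p i]%SET => i j aij; rewrite !finset.inE.
have aji := edge_sym aij.
have := hp i j (edge_neq aij); have := hq i j (edge_neq aij).
have := pq i; have := pq j; rewrite !mnmE /pair_exponents /=.
have ei := edge_weightE aij; have ej := edge_weightE aji.
by move: aij aji; rewrite ei ej; lia.
Qed.

End NormalGraphs.

(** * Splitting covers on bipartite graphs *)

Section BipartiteGraphs.
Variables (n : nat) (G : rel 'I_n) (c : 'I_n -> nat).
Hypotheses (Gsimple : simple_graph G) (Gbip : bipartite G) (c0 : forall i, (0 < c i)%N).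
Local Open Scope nat_scope.

Let a i j := c i * G i j.

Let a_gt0 i j : (0 < a i j) = G i j.
Proof. by rewrite muln_gt0 c0 lt0b. Qed.

Let a0 i j : a i j = 0 -> a j i = 0.
Proof.
by move/eqP; rewrite eqn0Ngt a_gt0 /a (proj1 Gsimple i j) => /negbTE ->; rewrite muln0.
Qed.

Let adiag i : a i i = 0.
Proof. by rewrite /a (proj2 Gsimple) muln0. Qed.

(* For a bipartition [V], a [(k+1)]-cover [m] dominates the cover consisting of
   the [i] in [V] with [m i] positive and the [j] outside [V] with [m j > k]
   (in units of [c]), and the difference is a [k]-cover. *)
Lemma bipartite_normal k : mon_pow (graph_exponents a) k = symbolic_exponents a k.
Proof.
apply/seteqP; split; first exact: mon_pow_sub_symbolic.
have [V hV] := Gbip; elim: k => [|k IH] m hm //.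
pose p := [multinom if (if i \in V then c i <= m i else k.+1 * c i <= m i)
                    then c i else 0 | i < n]%MM.
have pm : (p <= m)%MM.
  apply/mnm_lepP => i; rewrite mnmE; case: ifP => //; case: ifP => // _.
  by apply: leq_trans; rewrite leq_pmull.
exists p.
  move=> i j _; rewrite /pair_exponents /=; have [Gij|] := boolP (G i j); last first.
    by rewrite /a => /negbTE ->; rewrite muln0; left.
  have := hm i j; rewrite a_gt0 => /(_ Gij); rewrite /a -(proj1 Gsimple i j) Gij !muln1.
  rewrite !mnmE => kij; have := hV i j Gij.
  case: (i \in V); case: (j \in V) => // _.
    have [mi|/divn_small mi] := leqP (c i) (m i); first by left.
    right; rewrite ifT //; by move: kij; rewrite mi add0n leq_divRL.
  have [mj|/divn_small mj] := leqP (c j) (m j); first by right.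
  left; rewrite ifT //; by move: kij; rewrite mj addn0 leq_divRL.
exists (m - p)%MM; last by rewrite addmC submK.
apply: IH => i j; rewrite a_gt0 => Gij.
have := hm i j; rewrite a_gt0 => /(_ Gij); rewrite /a -(proj1 Gsimple i j) Gij !muln1.
have divB l : (m l - p l) %/ c l = m l %/ c l -
    (if l \in V then 1 <= m l %/ c l else k.+1 <= m l %/ c l).
  have divS : (m l - c l) %/ c l = m l %/ c l - 1 by rewrite -{1}[c l]mul1n divnBMl.
  rewrite !leq_divRL // mul1n mnmE; case: ifP => _.
    by have [_|_] := leqP (c l) (m l); rewrite ?subn0.
  by have [_|_] := leqP (k.+1 * c l) (m l); rewrite ?subn0.
(* If both ends of an edge lose a unit, the end outside [V] alone still has quotient at least
   [k]. *)
rewrite !mnmBE !divB; have := hV i j Gij.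
by case: (i \in V); case: (j \in V) => // _; lia.
Qed.

End BipartiteGraphs.

(** * Trivial modifications and the passage back to ideals *)

Section TrivialModifications.
Variables (K : fieldType) (n : nat).
Local Notation S := {mpoly K[n]}.
Implicit Types (G : rel 'I_n) (a : 'I_n -> 'I_n -> nat).

Lemma vertex_cover_idealE G : simple_graph G ->
  (vertex_cover_ideal G : set S) = ideal_of_exponents (fun i j => G i j : nat).
Proof.
move=> [Gsym Girr]; rewrite /vertex_cover_ideal ideal_of_exponents_mon.
transitivity (\bigcap_(e in [set e : 'I_n * 'I_n | G e.1 e.2])
  (mon_ideal (pair_exponents e.1 e.2 1 1) : set S)).
  by apply: eq_bigcapr => e _; rewrite -power_ideal2_mon /power_ideal2 !expr1.
rewrite mon_ideal_bigcap; congr mon_ideal; apply/seteqP; split=> m hm.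
  move=> i j ij; rewrite /pair_exponents /= (Gsym j).
  by case: (boolP (G i j)) => [Gij|_]; [exact: (hm (i, j))|left].
move=> [i j] /= Gij; have ij : i != j by apply: contraTneq Gij => ->; rewrite Girr.
by have := hm i j ij; rewrite (Gsym j) Gij.
Qed.

(** Scaled thresholds hold for [m] exactly when the original ones hold for the quotients
    [m i %/ c i]. So the scaled ideal depends only on the ideal and not on the matrix presenting
    it. *)
Lemma graph_exponents_scale a a' (c : 'I_n -> nat) : (forall i, (0 < c i)%N) ->
    graph_exponents a `<=` graph_exponents a' ->
  graph_exponents (fun i j => c i * a i j)%N `<=`
  graph_exponents (fun i j => c i * a' i j)%N.
Proof.
move=> c0 aa m hm i j ij.
have := aa [multinom m i %/ c i | i < n]%MM _ i j ij; rewrite /pair_exponents /= !mnmE.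
rewrite !leq_divRL // ![(_ * c _)%N]mulnC; apply=> k l kl.
have := hm k l kl; rewrite /pair_exponents /= !mnmE !leq_divRL //.
by rewrite ![(_ * c _)%N]mulnC.
Qed.

Lemma symbolic_power_mon a k : (forall i, a i i = 0%N) ->
    (forall i j, a i j = 0%N -> a j i = 0%N) ->
  symbolic_power (ideal_of_exponents a : set S) k = mon_ideal (symbolic_exponents a k).
Proof.
move=> adiag a0; rewrite symbolic_power_graph //.
transitivity (\bigcap_(e in [set e : 'I_n * 'I_n | (e.1 < e.2)%N /\ (0 < a e.1 e.2)%N])
  (mon_ideal [set m | (k <= m e.1 %/ a e.1 e.2 + m e.2 %/ a e.2 e.1)%N] : set S)).
  apply: eq_bigcapr => -[i j] [/= ij aij].
  rewrite power_ideal2_mon ideal_pow_mon ?mon_pow_pair //; last exact: upclosed_pair.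
    by rewrite -val_eqE /= ltn_eqF.
  exact: edge_sym.
rewrite mon_ideal_bigcap; congr mon_ideal; apply/seteqP; split=> m hm.
  move=> i j aij; have := edge_neq adiag aij; rewrite -val_eqE /= neq_ltn => /orP[ij|ji].
    exact: (hm (i, j)).
  by rewrite addnC; apply: (hm (j, i)); split=> //; apply: edge_sym aij.
by move=> [i j] [/= _ aij]; apply: hm.
Qed.

Lemma ideal_pow_graph a k :
  ideal_pow (ideal_of_exponents a : set S) k = mon_ideal (mon_pow (graph_exponents a) k).
Proof. by rewrite ideal_of_exponents_mon ideal_pow_mon //; apply: upclosed_graph. Qed.

Lemma trivial_modification_bipartite_normal (I : set S) G k : simple_graph G ->
    bipartite G -> trivial_modification I (vertex_cover_ideal G) ->
  ideal_pow I k = symbolic_power I k.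
Proof.
move=> Gs Gb [a [b [c [eG -> c0 eb]]]].
rewrite vertex_cover_idealE // !ideal_of_exponents_mon in eG; move/mon_ideal_inj: eG => eG.
(* The matrix [a] presenting the vertex cover ideal may differ from the adjacency matrix of [G], so
   it is replaced by the latter. *)
have -> : ideal_of_exponents b =
    ideal_of_exponents (fun i j => c i * G i j)%N :> set S.
  have -> : b = (fun i j => c i * a i j)%N by apply/funext => i; apply/funext => j.
  rewrite !ideal_of_exponents_mon; congr mon_ideal.
  by apply/seteqP; split; apply: graph_exponents_scale; rewrite // eG.
have [Gsym Girr] := Gs.
rewrite ideal_pow_graph symbolic_power_mon ?bipartite_normal //.
  by move=> i; rewrite Girr muln0.
move=> i j /eqP; rewrite muln_eq0 (gtn_eqF (c0 i)) eqb0 Gsym => /negbTE ->.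
by rewrite muln0.
Qed.

End TrivialModifications.

Theorem theorem2p3 (K : fieldType) (n : nat) (I : set {mpoly K[n]})
    (I_monomial : monomial_ideal I)
    (I_codim2 : has_height I 2)
    (I_unmixed : unmixed I 2)
    (I_gci : generically_complete_intersection I) :
  ((forall k : nat, ideal_pow I k = symbolic_power I k) <->
   ideal_pow I 2 = symbolic_power I 2) /\
  (ideal_pow I 2 = symbolic_power I 2 <->
   exists G : rel 'I_n,
     [/\ simple_graph G, bipartite G &
         trivial_modification I (vertex_cover_ideal G)]).
Proof.
suff normal_graph : ideal_pow I 2 = symbolic_power I 2 -> exists G : rel 'I_n,
    [/\ simple_graph G, bipartite G & trivial_modification I (vertex_cover_ideal G)].
  have graph_normal : (exists G : rel 'I_n, [/\ simple_graph G, bipartite G &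
      trivial_modification I (vertex_cover_ideal G)]) ->
      forall k, ideal_pow I k = symbolic_power I k.
    by move=> [G [Gs Gb IG]] k; apply: trivial_modification_bipartite_normal IG.
  split; first by split=> [->|/normal_graph/graph_normal].
  by split=> [/normal_graph|/graph_normal ->].
have [T Tup eI] := monomial_idealP I_monomial; rewrite eI in I_codim2 I_unmixed I_gci.
have [a [adiag a0 eT]] := unmixed_gci_exponents Tup I_codim2 I_unmixed I_gci.
have {}eI : I = ideal_of_exponents a by rewrite ideal_of_exponents_mon -eT.
rewrite eI ideal_pow_graph symbolic_power_mon // => /mon_ideal_inj e2.
have normal2 : symbolic_exponents a 2 `<=` mon_pow (graph_exponents a) 2 by rewrite e2.
pose G i j := (0 < a i j)%N.
have Gs : simple_graph G.
  split=> [i j|i]; last by rewrite /G adiag.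
  by apply/idP/idP; apply: edge_sym.
exists G; split=> //; first exact: normal_bipartite.
(* Isolated vertices have weight 0, while the scaling factors must be positive. *)
pose c i := maxn 1 (edge_weight a i).
exists (fun i j => G i j : nat), a, c; split=> //.
- exact: vertex_cover_idealE.
- by move=> i; rewrite leq_maxl.
move=> i j; rewrite /G; have [->|aij] := posnP (a i j); first by rewrite muln0.
rewrite muln1 (edge_weightE adiag a0 normal2 aij) /c.
by apply/esym/maxn_idPr; rewrite -(edge_weightE adiag a0 normal2 aij).
Qed.
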